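(* Let $q$ be an even prime power (that is, $q=2^k$ with $k\ge 1$) and define $\theta_q=\frac{\phi(q-1)}{q-1}$. If $\theta_q<\frac{8}{9}$, then $\mathbb{F}_q$ contains a pair of consecutive non-primitive elements, except when $q=4$ or $q=8$ (in these two cases no such pair exists).
   Context: $\phi$ denotes Euler's totient function and $\mathbb{F}_q$ the finite field with $q$ elements. An element of $\mathbb{F}_q^*$ is primitive if it generates the cyclic group $\mathbb{F}_q^*$; an element of $\mathbb{F}_q^*$ that is not primitive is called non-primitive. The element $0$ is regarded as neither primitive nor non-primitive. A pair of consecutive non-primitive elements (an NP pair) is a pair $(\beta,\beta+1)$ with $\beta\in\mathbb{F}_q$ such that both $\beta$ and $\beta+1$ are (nonzero) non-primitive elements. *)

(* Defs.v *)
From HB Require Import structures.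
From mathcomp Require Import all_boot all_order all_algebra all_fingroup all_solvable all_field.

Set Implicit Arguments.
Unset Strict Implicit.
Unset Printing Implicit Defensive.

Import Order.TTheory GRing.Theory Num.Theory.
Local Open Scope ring_scope.

Definition theta (q : nat) : rat := (totient q.-1)%:R / (q.-1)%:R.

(* {unit F} is the multiplicative group of F; in particular 0 is not primitive. *)
Definition primitive (F : finFieldType) (x : F) : bool :=
  [exists u : {unit F}, (val u == x) && generator [set: {unit F}] u].

Definition nonprimitive (F : finFieldType) (x : F) : bool :=
  (x != 0) && ~~ primitive x.

Definition NP_pair (F : finFieldType) (p : F * F) : bool :=
  [&& p.2 == p.1 + 1, nonprimitive p.1 & nonprimitive p.2].

(* Main.v *)
Require Import Defs.
From HB Require Import structures.
From mathcomp Require Import all_boot all_order all_algebra all_fingroup all_solvable all_field.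
From mathcomp Require Import zify ring.

Set Implicit Arguments.
Unset Strict Implicit.
Unset Printing Implicit Defensive.

Import Order.TTheory GRing.Theory Num.Theory.
Local Open Scope ring_scope.

(** The hypothesis on theta matters only because it forces the degree [k] to be
    composite, except when [q] is [4] or [8].

    If [k] has a divisor [a] with [1 < a < k], then [F] has a proper subfield
    of [2 ^ a > 2] elements.  None of its nonzero elements can generate the
    unit group of [F], and if [x] is one of its elements other than [0] and
    [1], then [x] and [x + 1] are both nonzero and both lie in it.  This is
    [NP_pair_of_subfield].

    If [k] is a prime [p >= 5], then theta is larger than [8 / 9], by
    [theta_Mersenne].  Every prime factor [r] of [2 ^ p - 1] satisfies
    [2 * p + 1 <= r], since the order of [2] modulo [r] is [p], so that [p]
    divides the even number [r - 1].  If there are [w] of them, then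
    [(2 * p + 1) ^ w < 2 ^ p], which forces [9 * w < 2 * p + 1]; and theta,
    the product of the [1 - 1 / r], is at least [1 - w / (2 * p + 1) > 8 / 9].

    What is left is [k <= 3].  For [q = 2] theta is [1].  For [q = 4] and
    [q = 8] the unit group has prime order, so that [1] is the only
    nonprimitive element and no pair exists. *)

Local Open Scope nat_scope.

(** It is enough that [p] divides the even number [r - 1].  Otherwise [p] and
    [r - 1] are coprime; both are exponents for which the power of [2] is [1]
    modulo [r], so a Bezout relation between them gives [2 = 1] modulo [r]. *)
Lemma Mersenne_factor_ge p r :
  prime p -> odd p -> prime r -> r %| (2 ^ p).-1 -> 2 * p + 1 <= r.
Proof.
move=> p_pr p_odd r_pr r_dvd.
have two_p : 2 ^ p = 1 %[mod r].
  by apply/eqP; rewrite eqn_mod_dvd ?expn_gt0 // subn1.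
have r_odd : odd r.
  case: (even_prime r_pr) => // r2; move: r_dvd; rewrite r2 dvdn2.
  by rewrite -subn1 oddB ?expn_gt0 // oddX; case: (p) p_pr.
have two_r : 2 ^ r.-1 = 1 %[mod r].
  by rewrite -(totient_prime r_pr); apply: Euler_exp_totient; rewrite coprime2n.
have r_gt1 := prime_gt1 r_pr.
have p_dvd : p %| r.-1.
  apply: contraT; rewrite -prime_coprime // => co.
  case: (egcdnP r.-1 (prime_gt0 p_pr)) => u v Bezout _.
  have : 2 ^ (u * p) = 2 ^ (v * r.-1 + 1) %[mod r].
    by rewrite Bezout (eqP co).
  rewrite expnD ![_ * p]mulnC ![_ * r.-1]mulnC !expnM.
  rewrite -modnXm two_p modnXm exp1n -modnMml -[(2 ^ r.-1) ^ v %% r]modnXm.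
  rewrite two_r modnXm modnMml exp1n mul1n => /esym/eqP.
  by rewrite eqn_mod_dvd // dvdn1 => /eqP r1; rewrite r1 in r_pr.
have : p * 2 %| r.-1.
  by rewrite Gauss_dvd ?coprimen2 // p_dvd dvdn2; move: r_odd r_gt1; case: (r).
by move/dvdn_leq; lia.
Qed.

Lemma exp_size_primes_le m n :
  0 < n -> (forall r, r \in primes n -> m <= r) -> m ^ size (primes n) <= n.
Proof.
move=> n_gt0; rewrite [leqRHS]prod_prime_decomp // prime_decompE big_map /=.
have : forall r, r \in primes n -> 0 < logn r n by move=> r; rewrite logn_gt0.
elim: (primes n) => [|r s IHs] e_gt0 ge_m; first by rewrite big_nil.
rewrite big_cons expnS leq_mul //.
  apply: leq_trans (ge_m r (mem_head _ _)) _.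
  have := e_gt0 r (mem_head _ _); case: (r) => // r' e_r_gt0.
  by rewrite -{1}[r'.+1]expn1 leq_pexp2l.
by apply: IHs => t ts; [apply: e_gt0|apply: ge_m]; rewrite inE ts orbT.
Qed.

(** The estimate [prod (1 - 1 / r) >= 1 - w / m] over the [w] prime factors
    [r >= m] of [n], with denominators cleared.  The truncated subtraction
    is harmless: the bound is trivial when [m <= w]. *)
Lemma totient_ge m n :
  0 < n -> (forall r, r \in primes n -> m <= r) ->
  n * (m - size (primes n)) <= m * totient n.
Proof.
move=> n_gt0; rewrite [X in X * _]prod_prime_decomp // totientE //.
rewrite prime_decompE big_map /=.
have : forall r, r \in primes n -> 0 < logn r n by move=> r; rewrite logn_gt0.
elim: (primes n) => [|r s IHs] e_gt0 ge_m.
  by rewrite !big_nil /= subn0 mul1n muln1.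
have le_mr := ge_m r (mem_head _ _).
have {}IHs := IHs (fun t ts => e_gt0 t (mem_behead (s := r :: s) ts))
                (fun t ts => ge_m t (mem_behead (s := r :: s) ts)).
rewrite !big_cons /= -[in X in X <= _](prednK (e_gt0 r (mem_head _ _))) expnS.
set A := \prod_(i <- s) _ in IHs *; set B := \prod_(i <- s) _ in IHs *.
set C := r ^ _.
have step : r * (m - (size s).+1) <= (m - size s) * r.-1 by nia.
rewrite [leqLHS](_ : _ = C * (A * (r * (m - (size s).+1)))); last by ring.
rewrite [leqRHS](_ : _ = C * (m * B * r.-1)); last by ring.
rewrite leq_mul2l; apply/orP; right.
apply: leq_trans (leq_mul (leqnn A) step) _.
by rewrite mulnA leq_mul2r IHs orbT.
Qed.

(** For [p >= 11] the base [2 * p + 1] is at least [23], and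
    [23 ^ 2 > 2 ^ 9], so [2 ^ (9 * w) <= (2 * p + 1) ^ (2 * w) < 2 ^ (2 * p)];
    for [p = 5] and [p = 7] the hypothesis already fails at [w = 2]. *)
Lemma exponent_bound p w :
  prime p -> 5 <= p -> (2 * p + 1) ^ w < 2 ^ p -> 9 * w < 2 * p + 1.
Proof.
move=> p_pr p_ge5 lt_w.
have [p_lt11 | p_ge11] := ltnP p 11.
  rewrite ltnNge; apply/negP => w_large.
  suff : (2 * p + 1) ^ 2 < 2 ^ p.
    by move: p p_lt11 p_pr p_ge5 {lt_w w_large}; do 11?[case=> //].
  by apply: leq_ltn_trans lt_w; rewrite leq_exp2l; lia.
have le_w : 2 ^ (9 * w) <= (2 * p + 1) ^ (2 * w).
  have [-> // | w_gt0] := posnP w.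
  rewrite !expnM leq_exp2r //; apply: (@leq_trans (23 ^ 2)) => //.
  by rewrite leq_exp2r //; lia.
have : 2 ^ (9 * w) < 2 ^ (2 * p).
  apply: leq_ltn_trans le_w _.
  by rewrite [2 * w]mulnC [in ltnRHS]mulnC !expnM ltn_exp2r.
by rewrite ltn_exp2l //; lia.
Qed.

Lemma theta_Mersenne p : prime p -> 5 <= p -> (8 / 9 < theta (2 ^ p))%R.
Proof.
move=> p_pr p_ge5; rewrite /theta; set n := (2 ^ p).-1.
have p_odd : odd p by case: (even_prime p_pr) p_ge5 => // ->.
have n_lt : n < 2 ^ p by rewrite /n prednK ?expn_gt0.
have n_gt0 : 0 < n.
  by rewrite /n -ltnS prednK ?expn_gt0 // -[X in X < _](expn0 2) ltn_exp2l; lia.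
have ge_m r : r \in primes n -> 2 * p + 1 <= r.
  by rewrite mem_primes => /and3P[r_pr _]; apply: Mersenne_factor_ge.
have w_lt : 9 * size (primes n) < 2 * p + 1.
  apply: exponent_bound => //.
  exact: leq_ltn_trans (exp_size_primes_le n_gt0 ge_m) n_lt.
have tot_ge := totient_ge n_gt0 ge_m.
have : 8 * n < 9 * totient n by nia.
rewrite -(ltr_nat rat) !natrM => lt_tot.
by rewrite ltr_pdivlMr ?ltr0n // mulrAC ltr_pdivrMr ?ltr0n // [ltRHS]mulrC.
Qed.

Local Open Scope ring_scope.

Lemma order_primitive (F : finFieldType) (x : F) d :
  Defs.primitive x -> x ^+ d = 1 -> (#|F|.-1 %| d)%N.
Proof.
case/existsP=> u /andP[/eqP <- /eqP gen_u] u_d.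
rewrite -card_finField_unit gen_u -/(#[u]%g) order_dvdn.
by apply/eqP/val_inj; rewrite /= FinRing.val_unitX.
Qed.

Lemma nonprimitive_exp1 (F : finFieldType) (x : F) d :
  (0 < d)%N -> (d < #|F|.-1)%N -> x ^+ d = 1 -> nonprimitive x.
Proof.
move=> d_gt0 d_lt x_d; apply/andP; split.
  by apply: contra_eq_neq x_d => ->; rewrite expr0n gtn_eqF // eq_sym oner_neq0.
apply/negP => /order_primitive/(_ x_d) /dvdn_leq -/(_ d_gt0).
by rewrite leqNgt d_lt.
Qed.

Lemma nonprimitive_eq1 (F : finFieldType) (x : F) :
  prime #|F|.-1 -> nonprimitive x -> x = 1.
Proof.
move=> pr_F /andP[x_neq0]; apply: contraNeq => x_neq1.
have Ux : x \is a GRing.unit by rewrite unitfE.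
pose u : {unit F} := FinRing.unit F Ux.
apply/existsP; exists u; rewrite eqxx /= /generator eq_sym eqEcard subsetT /=.
have u_neq1 : u != 1%g by rewrite -val_eqE.
have u_dvd : (#[u]%g %| #|F|.-1)%N.
  by rewrite -card_finField_unit; apply: order_dvdG; rewrite inE.
have /(prime_nt_dvdP pr_F) ord_u : #[u]%g != 1%N by rewrite order_eq1.
by rewrite card_finField_unit -(ord_u u_dvd) leqnn.
Qed.

(** The pair is [(x, x + 1)] with [x] a generator of the unit group of the
    subfield with [2 ^ a] elements; [x + 1] lies in that subfield because the
    Frobenius map is additive. *)
Lemma NP_pair_of_subfield (F : finFieldType) a k :
  #|F| = (2 ^ k)%N -> (a %| k)%N -> (1 < a < k)%N -> exists p : F * F, NP_pair p.
Proof.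
move=> cardF /dvdnP[b k_def] /andP[a_gt1 a_lt].
have pchar2 := card_finPcharP cardF isT.
set d := (2 ^ a).-1.
have two_a : (2 < 2 ^ a)%N by rewrite -[X in (X < _)%N](expn1 2) ltn_exp2l.
have d_succ : d.+1 = (2 ^ a)%N by rewrite /d prednK ?expn_gt0.
have d_gt1 : (1 < d)%N by rewrite -ltnS d_succ.
have d_lt : (d < #|F|.-1)%N.
  have : (2 ^ a < 2 ^ k)%N by rewrite ltn_exp2l.
  by rewrite cardF; lia.
have d_dvd : (d %| #|F|.-1)%N by rewrite cardF k_def mulnC expnM dvdn_pred_predX.
have [g gen_g] := cyclicP (field_unit_group_cyclic [set: {unit F}]).
have ord_g : #[g]%g = #|F|.-1 by rewrite -card_finField_unit gen_g.
pose u := (g ^+ (#|F|.-1 %/ d))%g; pose x : F := val u.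
have ord_u : #[u]%g = d.
  rewrite orderXdiv ord_g ?dvdn_div //.
  by rewrite divnA // mulKn //; lia.
have x_d : x ^+ d = 1.
  by rewrite -FinRing.val_unitX -ord_u expg_order.
have x_neq1 : x != 1.
  apply: contraL d_gt1 => /eqP x1.
  by rewrite -ord_u order_gt1 negbK -val_eqE; apply/eqP.
(* In characteristic two [x + 1] is [x - 1]. *)
have x1_neq0 : x + 1 != 0.
  by rewrite -(oppr_pchar2 pchar2 1) subr_eq0.
have x1_d : (x + 1) ^+ d = 1.
  apply: (mulfI x1_neq0); rewrite mulr1 -exprS d_succ exprDn_pchar.
    by rewrite expr1n -d_succ exprS x_d mulr1.
  by rewrite pnatX pnatE // pchar2.
exists (x, x + 1); apply/and3P; split => //=.
  by apply: (nonprimitive_exp1 _ d_lt x_d); lia.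
by apply: (nonprimitive_exp1 _ d_lt x1_d); lia.
Qed.

Lemma no_NP_pair (F : finFieldType) (p : F * F) : prime #|F|.-1 -> ~~ NP_pair p.
Proof.
move=> pr_F; apply/negP => /and3P[/eqP p2 /(nonprimitive_eq1 pr_F) p1_1].
move/(nonprimitive_eq1 pr_F); rewrite p2 p1_1 => /eqP.
by rewrite -subr_eq0 addrK oner_eq0.
Qed.

Theorem theorem1p1 (q k : nat) (k_ge1 : (1 <= k)%N) (q_even : q = (2 ^ k)%N)
    (F : finFieldType) (cardF : #|F| = q) :
  (theta q < 8 / 9 -> q <> 4%N -> q <> 8%N -> exists p : F * F, NP_pair p) /\
  (q = 4%N \/ q = 8%N -> ~ exists p : F * F, NP_pair p).
Proof.
split=> [theta_lt q_neq4 q_neq8 | q48]; last first.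
  have pr_F : prime #|F|.-1 by rewrite cardF; case: q48 => ->.
  by case=> p; apply/negP/no_NP_pair.
have [k_pr | ] := boolP (prime k).
  have k_lt5 : (k < 5)%N.
    rewrite ltnNge; apply/negP => /(theta_Mersenne k_pr).
    by rewrite -q_even => /(lt_trans theta_lt); rewrite ltxx.
  have k4 : k = 2%N \/ k = 3%N.
    by move: k k_lt5 k_pr {k_ge1 q_even}; do 5?[case=> //]; auto.
  by case: k4 q_even => -> q_def; [case: q_neq4|case: q_neq8].
case/primePns=> [k_lt2 | [a [a_pr a2_le a_dvd]]].
  have k1 : k = 1%N by lia.
  by move: theta_lt; rewrite q_even k1 /theta.
apply: (@NP_pair_of_subfield F a k) => //; first by rewrite cardF.
by have := prime_gt1 a_pr; nia.
Qed.
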